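(* For any positive integers $n$ and $k$, the following identity of formal power series in $q$ holds: $$\sum_{\Pi\in FA(n,k)}q^{|\Pi|}=q^{N}\sum_{\pi\in \mathrm{RPP}(\delta_{n+2k}/\delta_n)}q^{|\pi|},\qquad\text{where } N=\frac{k(k-1)(6n+8k-1)}{6},$$ and $FA(n,k)$ is the set of fixed points in $A(n,k)$ of the map $\Phi$ defined in the context.
   Context: $\delta_n=(n-1,n-2,\ldots,1)$ is the staircase shape partition. A reverse plane partition $\pi$ of skew shape $\lambda/\mu$ is an assignment of nonnegative integers to the squares of $\lambda/\mu$ that is weakly increasing along each row (left to right) and along each column (top to bottom); $\mathrm{RPP}(\lambda/\mu)$ is the set of these, and $|\pi|$ is the sum of the entries of $\pi$. An alternating word is a word $a_1a_2\cdots a_m$ of nonnegative integers with $a_1\ge a_2\le a_3\ge a_4\le\cdots$. A $k$-staircase alternating array $\Pi$ consists of $k$ rows of nonnegative integers, each row occupying consecutive columns of a grid, such that each row (read left to right) is an alternating word and, for $1\le i\le k-1$, the last entry of row $i+1$ lies exactly two columns to the right of the last entry of row $i$. Let $\ell_i$ be the number of entries in row $i$ and $\ell_i'=\ell_i-2i+2$. For a positive integer $n$, $\Pi$ is of order $n$ if $\{\ell_i' : 1\le i\le k\}=\{2n+1,2n+3,\ldots,2n+2k-1\}$. $A(n,k)$ is the set of $k$-staircase alternating arrays of order $n$. The permutation associated to $\Pi\in A(n,k)$ is the permutation $\sigma=\sigma_1\cdots\sigma_k$ of $\{1,\dots,k\}$ given by $\sigma_i=(\ell_i'-2n+1)/2$.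 For $i<j$, $\sigma_i>\sigma_j$ iff row $i$ starts to the left of row $j$. The weight $|\Pi|$ is the sum of all entries of $\Pi$. Transposability and $T_{i,j}$: let $1\le i<j\le k$, and consider the columns occupied by both row $i$ and row $j$ of $\Pi$; there is an odd number $p$ of them, and they are consecutive. They determine $p+1$ positions: immediately before the first common column, between two consecutive common columns, and immediately after the last common column. For each position, exchange the entries of rows $i$ and $j$ lying to the left of this position (entries keep their columns). If both resulting rows are again alternating words, the position is called a cutting position. Rows $i$ and $j$ of $\Pi$ are transposable if they have at least one cutting position; in this case $T_{i,j}(\Pi)\in A(n,k)$ is the array obtained from $\Pi$ by exchanging the entries of rows $i$ and $j$ lying to the left of the leftmost cutting position. If $i<j$ and $\sigma_i>\sigma_j$, then rows $i$ and $j$ are always transposable. Definition of $\Phi$ on $A(n,k)$: let $\Pi\in A(n,k)$ with associated permutation $\sigma$. If for every $1\le m<k$ rows $m$ and $m+1$ of $\Pi$ are not transposable, set $\Phi(\Pi)=\Pi$. Otherwise let $m_0$ be the smallest index $1\le m_0<k$ such that rows $m_0$ and $m_0+1$ of $\Pi$ are transposable. (A) If $\sigma_{m_0}<\sigma_{m_0+1}$, set $\Phi(\Pi)=T_{m_0,m_0+1}(\Pi)$. (B) If $\sigma_{m_0}>\sigma_{m_0+1}$, let $s$ ($1\le s\le m_0$) be the smallest index with $\sigma_s>\sigma_{m_0+1}$; rows $s$ and $m_0+1$ of $\Pi$ are then transposable. (I) If $s\ge 2$ and rows $s-1$ and $s$ of $T_{s,m_0+1}(\Pi)$ are transposable, then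 rows $s-1$ and $m_0+1$ of $\Pi$ are transposable, and one sets $\Phi(\Pi)=T_{s-1,m_0+1}(\Pi)$. (II) Otherwise, set $\Phi(\Pi)=T_{s,m_0+1}(\Pi)$. *)

(* Defs.v *)
From mathcomp Require Import all_boot finmap.
From mathcomp Require Import boolp classical_sets functions cardinality.

Set Implicit Arguments.
Unset Strict Implicit.
Unset Printing Implicit Defensive.

Local Open Scope classical_set_scope.

(* Formal power series in q with coefficients in nat, as coefficient
   sequences. *)
Definition fps := nat -> nat.

Definition fps_qpow (N : nat) : fps := fun m => m == N.

Definition fps_mul (f g : fps) : fps :=
  fun m => \sum_(i < m.+1) f i * g (m - i).

Definition level (T : choiceType) (A : set T) (w : T -> nat) (m : nat) : set T :=
  [set x | A x /\ w x = m].

(* sum_(x in A) q^(w x) is a well-defined formal power series. *)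
Definition summable (T : choiceType) (A : set T) (w : T -> nat) : Prop :=
  forall m, finite_set (level A w m).

(* The series sum_(x in A) q^(w x); it is meaningful only if [summable A w],
   because fset_set sends infinite sets to the empty set. *)
Definition genfun (T : choiceType) (A : set T) (w : T -> nat) : fps :=
  fun m => #|` fset_set (level A w m)|%fset.

(* delta n = (n-1, n-2, ..., 1) *)
Definition delta (n : nat) : seq nat := rev (iota 1 n.-1).

(* The squares (i, j) of lambda/mu, with rows and columns numbered from 0;
   head 0 lambda is the largest part of the partition lambda. *)
Definition in_skew (lambda mu : seq nat)
    (x : 'I_(size lambda) * 'I_(head 0 lambda)) : bool :=
  nth 0 mu x.1 <= x.2 < nth 0 lambda x.1.

Definition square (lambda mu : seq nat) := {x | @in_skew lambda mu x}.

Definition sqrow (lambda mu : seq nat) (x : square lambda mu) : nat :=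
  (val x).1.
Definition sqcol (lambda mu : seq nat) (x : square lambda mu) : nat :=
  (val x).2.

Definition RPP (lambda mu : seq nat) : set {ffun square lambda mu -> nat} :=
  [set pi : {ffun square lambda mu -> nat} |
    (forall x y, sqrow x = sqrow y -> sqcol x <= sqcol y -> pi x <= pi y) /\
    (forall x y, sqcol x = sqcol y -> sqrow x <= sqrow y -> pi x <= pi y)].
Arguments RPP : clear implicits.

Definition rpp_weight (lambda mu : seq nat)
    (pi : {ffun square lambda mu -> nat}) : nat := \sum_x pi x.
Arguments rpp_weight : clear implicits.

(* a_1 >= a_2 <= a_3 >= ...; the letter a_(i+1) is nth 0 w i. *)
Definition alternating (w : seq nat) : bool :=
  all (fun i => if odd i then nth 0 w i <= nth 0 w i.+1
                else nth 0 w i.+1 <= nth 0 w i)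
      (iota 0 (size w).-1).

(* An array is the list of its rows.  Rows are numbered from 0, so that row i
   here is row i+1 in 1-based numbering.  Horizontal positions are not stored:
   they are determined, up to a global translation, by the row lengths and by
   the rule that each row ends two columns to the right of the previous one. *)
Definition array := seq (seq nat).

Definition row (P : array) (i : nat) : seq nat := nth [::] P i.

(* l'_i = l_i - 2i + 2 for 1-based i, hence l_i - 2i for 0-based i; the
   truncated subtraction is harmless, as the values required in [A] are
   positive. *)
Definition lprime (P : array) (i : nat) : nat := size (row P i) - 2 * i.

Definition A (n k : nat) : set array :=
  [set P | [/\ size P = k, all alternating P
    & [seq lprime P i | i <- iota 0 k] =i
      [seq 2 * n + 2 * t + 1 | t <- iota 0 k]]].

Definition weight (P : array) : nat := \sum_(w <- P) \sum_(a <- w) a.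

Definition sigma (n : nat) (P : array) (i : nat) : nat :=
  (lprime P i + 1 - 2 * n) %/ 2.

(* The translation is fixed by putting the last entry of row i in column
   2(n+k-1) + 2i; then every array in A n k lies in columns >= 0, its leftmost
   row starting in column 0. *)
Definition lastcol (n k i : nat) : nat := 2 * (n + k - 1) + 2 * i.

Definition firstcol (n k : nat) (P : array) (i : nat) : nat :=
  (lastcol n k i).+1 - size (row P i).

(* A position is represented by the column immediately to its right: the
   entries to the left of position c are those in columns < c. *)
Definition positions (n k : nat) (P : array) (i j : nat) : seq nat :=
  let first := maxn (firstcol n k P i) (firstcol n k P j) in
  let last := minn (lastcol n k i) (lastcol n k j) in
  [seq c <- iota 0 last.+2 | first <= c].

(* The entries of row i in columns < c and in columns >= c. *)
Definition leftpart (n k : nat) (P : array) (c i : nat) : seq nat :=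
  take (c - firstcol n k P i) (row P i).
Definition rightpart (n k : nat) (P : array) (c i : nat) : seq nat :=
  drop (c - firstcol n k P i) (row P i).

Definition exchange (n k : nat) (P : array) (i j c : nat) : array :=
  let ri := leftpart n k P c j ++ rightpart n k P c i in
  let rj := leftpart n k P c i ++ rightpart n k P c j in
  set_nth [::] (set_nth [::] P i ri) j rj.

Definition cutting (n k : nat) (P : array) (i j c : nat) : bool :=
  alternating (row (exchange n k P i j c) i) &&
  alternating (row (exchange n k P i j c) j).

Definition transposable (n k : nat) (P : array) (i j : nat) : bool :=
  has (cutting n k P i j) (positions n k P i j).

(* Used only when rows i and j are transposable; [positions] is increasing, so
   the head is the leftmost cutting position. *)
Definition T (n k i j : nat) (P : array) : array :=
  exchange n k P i j
    (head 0 [seq c <- positions n k P i j | cutting n k P i j c]).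

(* The least i < r such that a i, or r if there is none. *)
Definition first_index (a : pred nat) (r : nat) : nat := find a (iota 0 r).

Definition Phi (n k : nat) (P : array) : array :=
  let m := first_index (fun m => transposable n k P m m.+1) k.-1 in
  if m == k.-1 then P
  else if sigma n P m < sigma n P m.+1 then T n k m m.+1 P
  else
    let s := first_index (fun s => sigma n P m.+1 < sigma n P s) m.+1 in
    if (1 <= s) && transposable n k (T n k s m.+1 P) s.-1 s
    then T n k s.-1 m.+1 P
    else T n k s m.+1 P.

Definition FA (n k : nat) : set array := [set P | A n k P /\ Phi n k P = P].

(* Main.v *)
Require Import Defs.
From mathcomp Require Import all_boot finmap zify.
From mathcomp Require Import boolp classical_sets functions cardinality.

Set Implicit Arguments.
Unset Strict Implicit.
Unset Printing Implicit Defensive.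

(** Exchanging the left parts of two rows also exchanges the columns in which
they start, and no two rows of an array in [A n k] start in the same column.
Hence [T] always changes an array in which it is applied to transposable rows,
and since every nontrivial branch of [Phi] applies [T] to such rows, the fixed
points of [Phi] are the arrays without a transposable pair of adjacent rows
([Phi_fixed]).

Extend every row by zeros to all columns.  As the rows start and end in even
columns, where the alternating words have their peaks, the added zeros respect
the zigzag inequalities, so whether a position is cutting depends only on the
four entries next to it.  Let [u] be the row that starts later and [v] the
other one.  If no position is cutting, then reading from left to right each
failure forces the next one, and every peak of [u] on the common columns is
smaller than both valleys of [v] beside it ([not_crossing_dominated]).  When
the upper row starts first this is absurd at its last column, beyond which it
has only zeros; so in a fixed array every row starts left of the previous one,
the permutation is the identity, and row i (counted from 0) has
2 (n + 2 i) + 1 entries.  The fixed arrays are therefore exactly those of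
[strict_strips]: rows of these lengths, each peak of a row being strictly
smaller than the two nearby valleys of the next row.

The skew shape delta (n + 2 k) / delta n is a union of 2 k consecutive
antidiagonals, which pair up into k zigzag border strips of these same lengths.
Reading each strip from bottom left to top right, the zigzag inequalities of
row i are the covering relations inside a strip, and the strict inequalities
between consecutive rows become, after i has been subtracted from row i, the
covering relations between consecutive strips ([strips_RPP], [RPP_strips]).
The total amount subtracted is the sum of i (2 (n + 2 i) + 1) over i < k, which
is the exponent N ([sum_strip_sizes]). *)

(** * Zigzag sequences and their splicings *)

Definition zig (t a b : nat) : bool := if odd t then a <= b else b <= a.

Definition zigzag (u : nat -> nat) : Prop := forall t, zig t (u t) (u t.+1).

Definition splice (c : nat) (u v : nat -> nat) (t : nat) : nat :=
  if t < c then u t else v t.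

(** Whether [u] and [v] remain zigzag when they are exchanged to the left of
column [t.+1]. *)
Definition crossing (u v : nat -> nat) (t : nat) : bool :=
  zig t (u t) (v t.+1) && zig t (v t) (u t.+1).

Lemma crossing_sym u v t : crossing u v t = crossing v u t.
Proof. by rewrite /crossing andbC. Qed.

(** Here [f] and [e] stand for the first and the last common column of two rows;
even columns carry the peaks of [u], odd columns the valleys of [v]. *)
Definition dominated (u v : nat -> nat) (f e : nat) : Prop :=
  forall x, ~~ odd x -> f <= x <= e -> u x < v x.-1 /\ u x < v x.+1.

Lemma zigzag_splice c u v : zigzag u -> zigzag v ->
  zigzag (splice c.+1 u v) <-> zig c (u c) (v c.+1).
Proof.
move=> zu zv; split=> [/(_ c)|zc t]; first by rewrite /splice ltnSn ltnn.
rewrite /splice; case: (ltngtP t c) => [tc|ct|->]; last by rewrite ltnSn ltnn.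
  by rewrite !ifT; [apply: zu | lia | lia].
by rewrite !ifF; [apply: zv | lia | lia].
Qed.

(** The failures propagate from left to right.  In column [f.-1], where [u]
vanishes, one of the two inequalities of a crossing holds trivially, so the
other one fails: the peak at [f] lies below the valley of [v] on its left.  At
an even column [x], a peak of [u] below the left valley lies below the peak of
[v] in the same column, so one inequality holds, and the failing one puts
[u x] below the right valley.  The same argument at [x.+1] then passes to the
next peak of [u]. *)
Lemma not_crossing_dominated u v f e : zigzag u -> zigzag v ->
  ~~ odd f -> 0 < f -> u f.-1 = 0 ->
  (forall t, f.-1 <= t <= e -> ~~ crossing u v t) -> dominated u v f e.
Proof.
move=> zu zv ef f0 uf nc.
have right_lt x : ~~ odd x -> f <= x <= e -> u x < v x.-1 -> u x < v x.+1.
  case: x => [|x] /= ex xfe; first by lia.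
  have := nc x.+1 ltac:(lia); have := zv x; have := zu x.+1.
  rewrite /crossing /zig /= (negbTE ex) (negbNE ex); lia.
have left_lt y : f + y.*2 <= e -> u (f + y.*2) < v (f + y.*2).-1.
  elim: y => [fe|y IH ye].
    rewrite addn0; have := nc f.-1 ltac:(lia).
    rewrite /crossing /zig (_ : odd f.-1) ?uf ?prednK ?leq0n //=; lia.
  set x := f + y.*2 in IH *; have ex : ~~ odd x by rewrite oddD odd_double; lia.
  have -> : f + y.+1.*2 = x.+2 by rewrite /x; lia.
  have lex : x.+2 <= e by rewrite /x; lia.
  have := right_lt x ex ltac:(lia) (IH ltac:(lia)).
  have := nc x.+1 ltac:(lia); have := zu x; have := zv x.+1.
  rewrite /crossing /zig /= (negbTE ex) /=; lia.
move=> x ex xfe; have lx : u x < v x.-1.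
  by have := left_lt (x - f)./2; rewrite (_ : f + _ = x) //; lia.
by split=> //; apply: right_lt.
Qed.

Lemma dominated_not_crossing u v f e : ~~ odd e -> ~~ odd f -> 0 < f ->
  dominated u v f e -> forall t, f.-1 <= t <= e -> ~~ crossing u v t.
Proof.
move=> ee ef f0 dom t te; rewrite /crossing /zig; case: (boolP (odd t)) => ot.
  by have [] := dom t.+1 ltac:(rewrite /=; lia) ltac:(lia); rewrite /=; lia.
by have [] := dom t ot ltac:(lia); lia.
Qed.

(** * Rows padded to a common left margin *)

(** Entries indexed by column, and 0 outside of the row; rows that start in
different columns become comparable, and splicing keeps every entry in its
column. *)
Definition pad (n k : nat) (P : array) (i : nat) : nat -> nat :=
  nth 0 (nseq (firstcol n k P i) 0 ++ row P i).

(** The last condition excludes rows too long for the grid, for which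
[firstcol] is truncated. *)
Definition well_placed (n k : nat) (P : array) (i : nat) : Prop :=
  [/\ alternating (row P i), ~~ odd (firstcol n k P i)
    & firstcol n k P i + size (row P i) = (lastcol n k i).+1].

Lemma alternating_nth w : alternating w <->
  forall t, t.+1 < size w -> zig t (nth 0 w t) (nth 0 w t.+1).
Proof.
split=> [/allP altw t tw|altw]; first by apply: altw; rewrite mem_iota; lia.
by apply/allP => t; rewrite mem_iota => tw; apply: altw; lia.
Qed.

(** The word begins and ends with a peak because its length is odd, so the zeros
on both sides of it obey the zigzag inequalities. *)
Lemma alternating_zigzag f w : ~~ odd f -> odd (size w) ->
  alternating w <-> zigzag (nth 0 (nseq f 0 ++ w)).
Proof.
move=> ef ow; have padE t : nth 0 (nseq f 0 ++ w) (f + t) = nth 0 w t.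
  by rewrite nth_cat size_nseq ltnNge leq_addr addKn.
have zigE t a b : zig (f + t) a b = zig t a b.
  by rewrite /zig oddD (negbTE ef).
split=> [/alternating_nth altw t|zw]; last first.
  by apply/alternating_nth => t _; have := zw (f + t); rewrite zigE -addnS !padE.
have [tf|ft] := ltnP t f.
  have t0 : nth 0 (nseq f 0 ++ w) t = 0.
    by rewrite nth_cat size_nseq tf nth_nseq tf.
  rewrite /zig t0; case: ifP => // ot.
  by rewrite nth_cat size_nseq ifT ?nth_nseq ?if_same //; lia.
rewrite -(subnKC ft) -addnS !padE zigE; move: (t - f) => {ft}t.
have [tw|wt] := ltnP t.+1 (size w); first exact: altw.
rewrite /zig [nth 0 w t.+1]nth_default; last by lia.
by case: ifP => // ot; rewrite nth_default //; lia.
Qed.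

Section Exchange.

Variables (n k : nat) (P : array).

Lemma mem_positions i j c : c \in positions n k P i j =
  (maxn (firstcol n k P i) (firstcol n k P j) <= c
     <= (minn (lastcol n k i) (lastcol n k j)).+1).
Proof. by rewrite mem_filter mem_iota add0n ltnS. Qed.

Lemma row_exchange i j c m : i != j ->
  row (exchange n k P i j c) m =
    if m == i then leftpart n k P c j ++ rightpart n k P c i
    else if m == j then leftpart n k P c i ++ rightpart n k P c j
    else row P m.
Proof.
move=> ij; rewrite /row /exchange !nth_set_nth /= !nth_set_nth /=.
by case: (eqVneq m i) => [->|]; first by rewrite (negbTE ij).
Qed.

Lemma odd_size_row i : well_placed n k P i -> odd (size (row P i)).
Proof. by case=> _ ef sz; rewrite /lastcol in sz; lia. Qed.

Lemma pad_zigzag i : well_placed n k P i -> zigzag (pad n k P i).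
Proof.
move=> wi; have [aw ef _] := wi.
by apply/(alternating_zigzag ef (odd_size_row wi)).
Qed.

Lemma pad_before i c : c < firstcol n k P i -> pad n k P i c = 0.
Proof. by move=> cf; rewrite /pad nth_cat size_nseq cf nth_nseq cf. Qed.

Lemma pad_after i c : well_placed n k P i -> lastcol n k i < c ->
  pad n k P i c = 0.
Proof. by case=> _ _ sz lc; rewrite /pad nth_default // size_cat size_nseq sz. Qed.

(** The hypotheses describe row [i] after an exchange with row [j] at [c], in an
array [Q] of which nothing else is known; as the situation is symmetric, they
apply to both of the rows that an exchange modifies. *)
Section Spliced.

Variables (i j c : nat) (Q : array).
Hypotheses (wi : well_placed n k P i) (wj : well_placed n k P j).
Hypothesis cp : c \in positions n k P i j.
Hypothesis rowQ : row Q i = leftpart n k P c j ++ rightpart n k P c i.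

Lemma firstcol_spliced : firstcol n k Q i = firstcol n k P j /\
  firstcol n k Q i + size (row Q i) = (lastcol n k i).+1.
Proof.
have [_ _ si] := wi; have [_ _ sj] := wj; move: cp; rewrite mem_positions.
rewrite geq_max => /andP[/andP[fi fj] ce].
have sQ : size (row Q i) = (lastcol n k i).+1 - firstcol n k P j.
  by rewrite rowQ size_cat size_take_min size_drop; lia.
have -> : firstcol n k Q i = firstcol n k P j.
  by rewrite {1}/firstcol sQ; lia.
by rewrite sQ; lia.
Qed.

Lemma pad_spliced : pad n k Q i =1 splice c (pad n k P j) (pad n k P i).
Proof.
have [_ _ si] := wi; have [_ _ sj] := wj; move: cp; rewrite mem_positions.
rewrite geq_max => /andP[/andP[fi fj] ce] t.
rewrite /pad (proj1 firstcol_spliced) rowQ /leftpart /rightpart.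
set u := nseq (firstcol n k P j) 0 ++ row P j.
set v := nseq (firstcol n k P i) 0 ++ row P i.
have -> : nseq (firstcol n k P j) 0 ++ take (c - firstcol n k P j) (row P j)
            ++ drop (c - firstcol n k P i) (row P i) = take c u ++ drop c v.
  by rewrite take_cat drop_cat !size_nseq !ltnNge fi fj catA.
rewrite /splice nth_cat size_takel; last by rewrite size_cat size_nseq; lia.
case: ltnP => tc; first by rewrite nth_take.
by rewrite nth_drop subnKC.
Qed.

Lemma alternating_spliced : c > 0 ->
  alternating (row Q i) = zig c.-1 (pad n k P j c.-1) (pad n k P i c).
Proof.
move=> c0; have [fQ sQ] := firstcol_spliced; have [_ ej _] := wj.
have oQ : odd (size (row Q i)) by rewrite /lastcol fQ in sQ; lia.
have eQ : ~~ odd (firstcol n k Q i) by rewrite fQ.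
have altE := iff_trans (alternating_zigzag eQ oQ)
  (iff_trans _ (zigzag_splice c.-1 (pad_zigzag wj) (pad_zigzag wi))).
rewrite prednK // in altE.
apply/idP/idP => /altE; apply; split=> zq t; have := zq t;
  by rewrite -!pad_spliced.
Qed.

End Spliced.

Lemma cuttingE i j c : well_placed n k P i -> well_placed n k P j -> i != j ->
  c \in positions n k P i j -> 0 < c ->
  cutting n k P i j c = crossing (pad n k P i) (pad n k P j) c.-1.
Proof.
move=> wi wj ij cp c0.
have rowi := row_exchange c i ij; rewrite eqxx in rowi.
have rowj := row_exchange c j ij; rewrite eq_sym (negbTE ij) eqxx in rowj.
have cp' : c \in positions n k P j i.
  by rewrite mem_positions maxnC minnC -mem_positions.
rewrite /cutting (alternating_spliced wi wj cp rowi c0).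
rewrite (alternating_spliced wj wi cp' rowj c0).
by rewrite /crossing prednK // andbC.
Qed.

Lemma well_placed_spliced i j c Q : well_placed n k P i -> well_placed n k P j ->
  c \in positions n k P i j ->
  row Q i = leftpart n k P c j ++ rightpart n k P c i ->
  alternating (row Q i) -> well_placed n k Q i.
Proof.
move=> wi wj cp rowQ altQ; have [fQ sQ] := firstcol_spliced wi wj cp rowQ.
by split=> //; rewrite fQ; case: wj.
Qed.

(** text *)
Lemma not_transposable_dominated i j : well_placed n k P i ->
  well_placed n k P j -> i < j -> firstcol n k P j < firstcol n k P i ->
  ~~ transposable n k P i j ->
  dominated (pad n k P i) (pad n k P j) (firstcol n k P i) (lastcol n k i).
Proof.
move=> wi wj ij fji /hasPn nt; have [_ ei si] := wi.
apply: not_crossing_dominated; rewrite ?pad_before; try exact: pad_zigzag; try lia.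
move=> t ft; have c_pos : t.+1 \in positions n k P i j.
  by rewrite mem_positions /lastcol in ft *; lia.
by have := nt _ c_pos; rewrite cuttingE //; lia.
Qed.

Lemma dominated_not_transposable i j : well_placed n k P i ->
  well_placed n k P j -> i < j -> firstcol n k P j < firstcol n k P i ->
  dominated (pad n k P i) (pad n k P j) (firstcol n k P i) (lastcol n k i) ->
  ~~ transposable n k P i j.
Proof.
move=> wi wj ij fji dom; have [_ ei si] := wi; apply/hasPn => c c_pos.
move: (c_pos); rewrite mem_positions => c_rng; rewrite cuttingE //; try lia.
apply: (dominated_not_crossing _ ei _ dom); rewrite /lastcol in c_rng *; lia.
Qed.

(** Otherwise the peaks of row [j] would be dominated by row [i] up to the last
column of row [i], where the valley on the right is a padding zero. *)
Lemma inversion_transposable i j : well_placed n k P i ->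
  well_placed n k P j -> i < j ->
  firstcol n k P i < firstcol n k P j <= lastcol n k i ->
  transposable n k P i j.
Proof.
move=> wi wj ij fij; apply/negPn/negP => /hasPn nt; have [_ ej sj] := wj.
have dom : dominated (pad n k P j) (pad n k P i) (firstcol n k P j) (lastcol n k i).
  apply: not_crossing_dominated; rewrite ?pad_before; try exact: pad_zigzag; try lia.
  move=> t ft; have c_pos : t.+1 \in positions n k P i j.
    by rewrite mem_positions /lastcol in ft fij *; lia.
  by have := nt _ c_pos; rewrite cuttingE // 1?crossing_sym //; lia.
have := dom (lastcol n k i); rewrite /= [pad n k P i _.+1]pad_after // leqnn andbT.
by case=> //; [rewrite /lastcol; lia | case/andP: fij].
Qed.

End Exchange.

(** * Fixed points of the involution *)

Lemma first_index_spec (a : pred nat) r :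
  [/\ first_index a r <= r, first_index a r < r -> a (first_index a r)
    & forall x, x < first_index a r -> ~~ a x].
Proof.
have le_r : first_index a r <= r by rewrite -[leqRHS](size_iota 0) find_size.
split=> // [lt_r|x ltx].
  have has_a : has a (iota 0 r) by rewrite has_find size_iota.
  by have := nth_find 0 has_a; rewrite nth_iota.
by have := before_find 0 ltx; rewrite nth_iota ?(leq_trans ltx) // => ->.
Qed.

Section FixedPoints.

Variables (n k : nat) (P : array).

Lemma T_exchange i j : transposable n k P i j -> exists c,
  [/\ c \in positions n k P i j, cutting n k P i j c
    & T n k i j P = exchange n k P i j c].
Proof.
rewrite /transposable has_filter /T => ne.
set cs := filter _ _ in ne *.
have : head 0 cs \in cs by case: cs ne => //= c cs _; rewrite mem_head.
by rewrite mem_filter => /andP[? ?]; exists (head 0 cs).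
Qed.

Hypothesis AP : A n k P.

Lemma A_row i : i < k ->
  [/\ 0 < sigma n P i <= k,
      size (row P i) = 2 * (n + sigma n P i + i) - 1,
      firstcol n k P i = 2 * (k - sigma n P i)
    & well_placed n k P i].
Proof.
move=> ik; have [sP altP lE] := AP.
have : lprime P i \in [seq lprime P i | i <- iota 0 k].
  by apply: map_f; rewrite mem_iota.
rewrite lE => /mapP[t]; rewrite mem_iota add0n /= => tk {}lE.
have sE : sigma n P i = t.+1 by rewrite /sigma lE; lia.
have rE : size (row P i) = 2 * (n + t.+1 + i) - 1 by rewrite /lprime in lE; lia.
have fE : firstcol n k P i = 2 * (k - t.+1) by rewrite /firstcol rE /lastcol; lia.
rewrite sE; split=> //; split; rewrite ?fE ?rE /lastcol; try lia.
by apply: (allP altP); rewrite mem_nth ?sP.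
Qed.

Lemma sigma_inj i j : i < k -> j < k -> sigma n P i = sigma n P j -> i = j.
Proof.
move=> ik jk eqs; have [_ _ lE] := AP.
have uniq_l : uniq [seq lprime P i | i <- iota 0 k].
  rewrite (@uniq_size_uniq _ [seq 2 * n + 2 * t + 1 | t <- iota 0 k]).
  - by rewrite !size_map.
  - by rewrite map_inj_uniq ?iota_uniq // => x y; lia.
  - by move=> x; rewrite lE.
have [_ si _ _] := A_row ik; have [_ sj _ _] := A_row jk.
apply/eqP; rewrite -(nth_uniq 0 _ _ uniq_l) ?size_map ?size_iota //.
by rewrite !(nth_map 0) ?size_iota // !nth_iota // /lprime si sj eqs; lia.
Qed.

(** The exchange swaps the starting columns, which are distinct. *)
Lemma T_neq i j : i < j < k -> transposable n k P i j -> T n k i j P <> P.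
Proof.
move=> /andP[ij jk] /T_exchange[c [cp _ ->]] fixed.
have ik := ltn_trans ij jk.
have [si _ fi wi] := A_row ik; have [sj _ fj wj] := A_row jk.
have rowQ : row P i = leftpart n k P c j ++ rightpart n k P c i.
  by rewrite -{1}fixed row_exchange ?eqxx // ltn_eqF.
have [fij _] := firstcol_spliced wi wj cp rowQ.
by suff : i = j; [lia | apply: sigma_inj; lia].
Qed.

Lemma A_not_transposable i j : i < j < k -> ~~ transposable n k P i j ->
  sigma n P i < sigma n P j /\
  dominated (pad n k P i) (pad n k P j) (firstcol n k P i) (lastcol n k i).
Proof.
move=> /andP[ij jk] nt; have ik := ltn_trans ij jk.
have [si ri fi wi] := A_row ik; have [sj rj fj wj] := A_row jk.
have [lt_s|gt_s|/sigma_inj] := ltngtP (sigma n P i) (sigma n P j).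
- by split=> //; apply: not_transposable_dominated => //; lia.
- by rewrite inversion_transposable // in nt; rewrite /lastcol; lia.
- by move/(_ ik jk); lia.
Qed.

(** This ensures that the branch of [Phi] testing transposability after a first
exchange then applies [T] to transposable rows.  If rows [s] and [j] were not
transposable, row [j], like row [s.+1], would dominate row [s]; the row spliced
from these two would then also dominate row [s], and could not be transposable
with it. *)
Lemma transposable_of_spliced s j : s.+1 < j < k -> sigma n P s <= sigma n P j ->
  sigma n P j < sigma n P s.+1 -> ~~ transposable n k P s s.+1 ->
  transposable n k (T n k s.+1 j P) s s.+1 -> transposable n k P s j.
Proof.
move=> /andP[sj jk] le_a lt_b nt_ab; apply: contraTT => nt_ac.
have bk := ltn_trans sj jk; have ak := ltnW bk.
have [sa _ fa wa] := A_row ak; have [sb _ fb wb] := A_row bk.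
have [sc _ fc wc] := A_row jk.
have [_ dom_ab] := A_not_transposable (i := s) (j := s.+1) ltac:(lia) nt_ab.
have [_ dom_ac] := A_not_transposable (i := s) (j := j) ltac:(lia) nt_ac.
have /T_exchange[c [cp /andP[alt_b _] ->]] : transposable n k P s.+1 j.
  by apply: inversion_transposable => //; rewrite /lastcol; lia.
have neq_bc : s.+1 != j by rewrite ltn_eqF.
set Q := exchange _ _ _ _ _ _.
have rowa : row Q s = row P s by rewrite row_exchange // !ifN //; lia.
have rowb : row Q s.+1 = leftpart n k P c j ++ rightpart n k P c s.+1.
  by rewrite row_exchange // eqxx.
have faQ : firstcol n k Q s = firstcol n k P s by rewrite /firstcol rowa.
have wbQ := well_placed_spliced wb wc cp rowb alt_b.
have [fbQ _] := firstcol_spliced wb wc cp rowb.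
apply: dominated_not_transposable => //.
- by rewrite /well_placed faQ rowa.
- have := @sigma_inj s j ak jk; lia.
- move=> x ex; rewrite faQ => xr.
  rewrite !(pad_spliced wb wc cp rowb) /pad rowa faQ -/(pad n k P s).
  have [? ?] := dom_ab x ex xr; have [? ?] := dom_ac x ex xr.
  by rewrite /splice; split; case: ifP.
Qed.

Lemma Phi_fixed : Phi n k P = P <->
  forall m, m.+1 < k -> ~~ transposable n k P m m.+1.
Proof.
rewrite /Phi; set m := first_index _ _; have [le_m tr_m nt_m] :=
  first_index_spec (fun m => transposable n k P m m.+1) k.-1.
rewrite -/m in le_m tr_m nt_m; split=> [|nt]; last first.
  by case: eqVneq => // ne_m; have := nt m; rewrite tr_m; lia.
case: eqVneq => [eq_m _ i ik|ne_m]; first by apply: nt_m; lia.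
have {}tr_m : transposable n k P m m.+1 by apply: tr_m; lia.
have mk : m.+1 < k by lia.
case: ifP => [_|ge_s] fixed; first by case: (T_neq _ tr_m fixed); lia.
exfalso; move: fixed.
have gt_s : sigma n P m.+1 < sigma n P m by have := @sigma_inj m m.+1; lia.
set s := first_index _ _; have [le_s inv_s min_s] := first_index_spec
  (fun s => sigma n P m.+1 < sigma n P s) m.+1.
rewrite -/s in le_s inv_s min_s.
have sm : s <= m by rewrite leqNgt; apply/negP => /min_s; rewrite gt_s.
have {}inv_s : sigma n P m.+1 < sigma n P s by apply: inv_s.
have tr_s : transposable n k P s m.+1.
  apply/negPn/negP => /(A_not_transposable (i := s) (j := m.+1)).
  by rewrite ltnS sm mk => /(_ isT)[]; lia.
case: ifP => [/andP[s0 trT]|_]; last by apply: T_neq; rewrite // ltnS sm.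
apply: T_neq; first by lia.
move: (sm) (nt_m s.-1) (min_s s.-1) inv_s tr_s trT.
case: (s) s0 => // s' _ /= ss ntm mins inv tr.
apply: transposable_of_spliced => //; first by lia.
  by rewrite leqNgt mins.
by apply: ntm.
Qed.

End FixedPoints.

(** * The fixed arrays as strips *)

Definition strict_strips (n k : nat) (P : array) : Prop :=
  [/\ size P = k,
      forall i, i < k ->
        size (row P i) = (2 * (n + 2 * i)).+1 /\ alternating (row P i)
    & forall i t, i.+1 < k -> ~~ odd t -> t <= 2 * (n + 2 * i) ->
        nth 0 (row P i) t < nth 0 (row P i.+1) t.+1 /\
        nth 0 (row P i) t < nth 0 (row P i.+1) t.+3].

Lemma pad_row n k P i t :
  pad n k P i (firstcol n k P i + t) = nth 0 (row P i) t.
Proof. by rewrite /pad nth_cat size_nseq ltnNge leq_addr addKn. Qed.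

Lemma strips_placed n k P i : strict_strips n k P -> i < k ->
  firstcol n k P i = 2 * (k - i.+1) /\ well_placed n k P i.
Proof.
move=> [_ rowP _] ik; have [sz alt] := rowP i ik.
have fE : firstcol n k P i = 2 * (k - i.+1).
  by rewrite /firstcol sz /lastcol; lia.
by split=> //; split; rewrite // ?fE ?sz /lastcol; lia.
Qed.

Lemma fixed_strips n k P : FA n k P -> strict_strips n k P.
Proof.
move=> [AP /(Phi_fixed AP) nt].
have step i : i.+1 < k -> sigma n P i < sigma n P i.+1.
  by move=> ik; case: (A_not_transposable AP _ (nt i ik)); rewrite ?ltnSn.
have incr i d : i + d < k -> sigma n P i + d <= sigma n P (i + d).
  elim: d => [|d IH] idk; rewrite ?addn0 // addnS.
  by have := step (i + d); rewrite -addnS idk => /(_ isT); lia.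
have sigE i : i < k -> sigma n P i = i.+1.
  (* k increasing values between 1 and k: compare with the first and the last *)
  move=> ik; have := incr 0 i ik; have := incr i (k.-1 - i); rewrite add0n.
  have [|s0 _ _ _] := A_row AP (i := 0); first by lia.
  have [|sk _ _ _] := A_row AP (i := i + (k.-1 - i)); first by lia.
  by move=> /(_ ltac:(lia)); lia.
have [sP _ _] := AP; split=> // [i ik|i t ik et lt].
  have [_ rE _ [alt _ _]] := A_row AP ik; split=> //.
  by rewrite rE sigE //; lia.
have ik' := ltnW ik.
have [_ _ fE _] := A_row AP ik'; have [_ _ fE' _] := A_row AP ik.
have [_ dom] := A_not_transposable (i := i) (j := i.+1) AP ltac:(lia) (nt i ik).
rewrite sigE // in fE; rewrite sigE // in fE'.
have := dom (firstcol n k P i + t); rewrite pad_row fE => -[||].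
- by lia.
- by rewrite /lastcol; lia.
have -> : (2 * (k - i.+1) + t).-1 = firstcol n k P i.+1 + t.+1 by lia.
have -> : (2 * (k - i.+1) + t).+1 = firstcol n k P i.+1 + t.+3 by lia.
by rewrite !pad_row.
Qed.

Lemma strips_fixed n k P : strict_strips n k P -> FA n k P.
Proof.
move=> sP; have [szP rowP lt_rows] := sP.
have AP : A n k P.
  split=> //.
    by apply/(all_nthP [::]) => i; rewrite szP => /rowP[].
  move=> x; congr (_ \in _); apply/eq_in_map => i; rewrite mem_iota => ik.
  by rewrite /lprime (proj1 (rowP i _)) //; lia.
split=> //; apply/(Phi_fixed AP) => i ik; have ik' := ltnW ik.
have [fE wi] := strips_placed sP ik'; have [fE' wi'] := strips_placed sP ik.
apply: dominated_not_transposable => //; first by lia.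
move=> x ex; rewrite /lastcol fE => xr.
have := lt_rows i (x - firstcol n k P i) ik; rewrite fE => -[||].
- by lia.
- by lia.
rewrite -!(pad_row n k) fE fE'.
have -> : 2 * (k - i.+1) + (x - 2 * (k - i.+1)) = x by lia.
have -> : 2 * (k - i.+2) + (x - 2 * (k - i.+1)).+1 = x.-1 by lia.
by have -> : 2 * (k - i.+2) + (x - 2 * (k - i.+1)).+3 = x.+1 by lia.
Qed.

(** Every entry of a row exceeds some peak of the previous row, which makes the
subtraction of [i] from row [i] reversible. *)
Lemma strips_ge n k P i t : strict_strips n k P -> i < k ->
  t <= 2 * (n + 2 * i) -> i <= nth 0 (row P i) t.
Proof.
move=> sP; have [_ rowP lt_rows] := sP.
elim: i t => // i IH t ik lt.
have [sz alt] := rowP _ ik.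
have odd_gt u : odd u -> u <= 2 * (n + 2 * i.+1) -> i < nth 0 (row P i.+1) u.
  case: u => [|u] //= eu lu; have [le_u|gt_u] := leqP u (2 * (n + 2 * i)).
    by apply: leq_ltn_trans (proj1 (lt_rows i u ik eu le_u)); apply: IH; lia.
  case: u => [|[|u]] in eu lu gt_u *; try by lia.
  have eu' : ~~ odd u by rewrite /= negbK in eu.
  have le_u : u <= 2 * (n + 2 * i) by lia.
  by apply: leq_ltn_trans (proj2 (lt_rows i u ik eu' le_u)); apply: IH; lia.
case: (boolP (odd t)) => [/odd_gt|et]; first exact.
have zigP := (alternating_nth _).1 alt; rewrite sz in zigP.
case: t et lt => [|t] /= et lt.
  by apply: leq_trans (odd_gt 1 isT _) (zigP 0 _); lia.
apply: leq_trans (odd_gt t _ _) _; try by lia.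
by have := zigP t lt; rewrite /zig (negbNE et).
Qed.

(** * Reverse plane partitions as strips *)

Lemma nth_delta m i : nth 0 (delta m) i = m.-1 - i.
Proof.
rewrite /delta; have [im|mi] := ltnP i m.-1.
  by rewrite nth_rev ?size_iota // nth_iota; lia.
by rewrite nth_default ?size_rev ?size_iota //; lia.
Qed.

Section Squares.

Variables n k : nat.
Hypothesis hn : 0 < n.

Notation shape := (delta (n + 2 * k)).
Notation sq := (square shape (delta n)).
Implicit Types x y : sq.

(** Squares with [strip x = i] form the [i]-th border strip from the top left,
consisting of the antidiagonals of length [n + 2 * i] (valleys) and
[n + 2 * i + 1] (peaks); [place x] is the rank of [x] in its strip, read from
bottom left to top right. *)
Definition strip x : nat := (sqrow x + sqcol x + 1 - n)./2.
Definition place x : nat := (sqcol x).*2 + odd (n + sqrow x + sqcol x).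

Lemma square_bounds x :
  n.-1 <= sqrow x + sqcol x < (n + 2 * k).-1.
Proof.
have := valP x; rewrite /in_skew !nth_delta -/(sqrow x) -/(sqcol x).
by lia.
Qed.

Lemma square_at r c : n.-1 <= r + c < (n + 2 * k).-1 ->
  exists x, sqrow x = r /\ sqcol x = c.
Proof.
move=> rc.
have r_lt : r < size shape by rewrite size_rev size_iota; lia.
have c_lt : c < head 0 shape by rewrite -nth0 nth_delta; lia.
have skew : in_skew (delta n) (Ordinal r_lt, Ordinal c_lt).
  by rewrite /in_skew !nth_delta /=; lia.
by exists (exist _ (Ordinal r_lt, Ordinal c_lt) skew).
Qed.

Lemma square_inj x y : sqrow x = sqrow y -> sqcol x = sqcol y -> x = y.
Proof.
rewrite /sqrow /sqcol => eq_r eq_c; apply/val_inj.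
case: (val x) (val y) eq_r eq_c => [r c] [r' c'] /= /val_inj-> /val_inj->.
by [].
Qed.

Lemma square_coords x : [/\ strip x < k, place x <= 2 * (n + 2 * strip x),
  sqcol x = (place x)./2 & sqrow x + uphalf (place x) = n + 2 * strip x].
Proof. by have := square_bounds x; rewrite /strip /place; split; lia. Qed.

Lemma square_in_strip i t : i < k -> t <= 2 * (n + 2 * i) ->
  exists x, strip x = i /\ place x = t.
Proof.
move=> ik lt; have [|x [rx cx]] := @square_at (n + 2 * i - uphalf t) t./2.
  by lia.
by exists x; rewrite /strip /place rx cx; split; lia.
Qed.

Lemma strip_place_inj x y : strip x = strip y -> place x = place y -> x = y.
Proof.
move=> eq_s eq_p; have [_ _ cx rx] := square_coords x.
have [_ _ cy ry] := square_coords y.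
by apply: square_inj; rewrite ?cx ?cy ?eq_p //; rewrite eq_s eq_p in rx; lia.
Qed.

Definition covers x y : bool :=
  [&& sqrow x <= sqrow y, sqcol x <= sqcol y
    & sqrow y + sqcol y == (sqrow x + sqcol x).+1].

(** A skew shape is convex, so a monotone path of covering steps inside the
shape joins any two comparable squares. *)
Lemma RPP_covers (pi : {ffun sq -> nat}) :
  RPP shape (delta n) pi <-> forall x y, covers x y -> pi x <= pi y.
Proof.
split=> [[rowP colP] x y /and3P[rxy cxy /eqP dxy]|covP].
  have [eq_r|ne_r] := eqVneq (sqrow x) (sqrow y); first exact: rowP.
  by apply: colP => //; lia.
suff le_pi d x y : sqrow x <= sqrow y -> sqcol x <= sqcol y ->
    sqrow y + sqcol y = sqrow x + sqcol x + d -> pi x <= pi y.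
  split=> x y eq_xy le_xy.
    by apply: (le_pi (sqcol y - sqcol x)); lia.
  by apply: (le_pi (sqrow y - sqrow x)); lia.
elim: d x => [|d IH] x le_r le_c dE.
  by rewrite (@square_inj x y) //; lia.
have := square_bounds x; have := square_bounds y => by_ bx.
have [z [cov rz cz]] : exists z,
    [/\ covers x z, sqrow z <= sqrow y & sqcol z <= sqcol y].
  have [lt_r|ge_r] := ltnP (sqrow x) (sqrow y).
    have [|z [rz cz]] := @square_at (sqrow x).+1 (sqcol x); first by lia.
    by exists z; rewrite /covers rz cz; split=> //; lia.
  have [|z [rz cz]] := @square_at (sqrow x) (sqcol x).+1; first by lia.
  by exists z; rewrite /covers rz cz; split=> //; lia.
apply: leq_trans (covP _ _ cov) (IH _ rz cz _).
by move: cov; rewrite /covers; lia.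
Qed.

(** The sum has a single term when the strip [i] has a place [t]; it avoids
computing the square with these coordinates. *)
Definition entry (pi : {ffun sq -> nat}) (i t : nat) : nat :=
  \sum_(x | (strip x == i) && (place x == t)) pi x.

Definition strips (pi : {ffun sq -> nat}) : array :=
  mkseq (fun i => mkseq (fun t => entry pi i t + i) (2 * (n + 2 * i)).+1) k.

Lemma row_strips pi i : i < k ->
  row (strips pi) i = mkseq (fun t => entry pi i t + i) (2 * (n + 2 * i)).+1.
Proof. by move=> ik; rewrite /row nth_mkseq. Qed.

Lemma entry_square pi x : entry pi (strip x) (place x) = pi x.
Proof.
rewrite /entry (big_pred1 x) // => y /=.
apply/andP/eqP => [[/eqP ? /eqP ?]|->]; last by rewrite !eqxx.
exact: strip_place_inj.
Qed.

Lemma nth_strips pi x :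
  nth 0 (row (strips pi) (strip x)) (place x) = pi x + strip x.
Proof.
have [ik lt _ _] := square_coords x.
by rewrite row_strips // nth_mkseq ?ltnS // entry_square.
Qed.

Lemma strips_inj : injective strips.
Proof.
move=> pi1 pi2 eq_pi; apply/ffunP => x; apply: (@addIn (strip x)).
by rewrite -!nth_strips eq_pi.
Qed.

Lemma sum_strip (pi : {ffun sq -> nat}) i :
  \sum_(t < (2 * (n + 2 * i)).+1) entry pi i t = \sum_(x | strip x == i) pi x.
Proof.
rewrite (partition_big (fun x => inord (place x) : 'I_(2 * (n + 2 * i)).+1)
  xpredT) //=.
apply: eq_bigr => t _; apply: eq_bigl => x.
case: (strip x =P i) => //= sx; have [_ lt _ _] := square_coords x.
by rewrite -val_eqE /= inordK // ltnS -sx.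
Qed.

Lemma sum_strip_sizes m :
  6 * (\sum_(i < m) (2 * (n + 2 * i)).+1 * i) =
  m * (m - 1) * (6 * n + 8 * m - 1).
Proof.
elim: m => [|m IH]; first by rewrite big_ord0.
rewrite big_ord_recr /= mulnDr IH; case: m {IH} => [|m]; first by lia.
have -> : 6 * n + 8 * m.+1 - 1 = 6 * n + 8 * m + 7 by lia.
have -> : 6 * n + 8 * m.+2 - 1 = 6 * n + 8 * m + 15 by lia.
by rewrite !subSS !subn0; lia.
Qed.

Lemma sum_mkseq T (f : nat -> T) (F : T -> nat) m :
  \sum_(a <- mkseq f m) F a = \sum_(i < m) F (f i).
Proof. by rewrite big_map -[m in iota _ m]subn0 big_mkord. Qed.

Lemma weight_strips pi : weight (strips pi) =
  (k * (k - 1) * (6 * n + 8 * k - 1)) %/ 6 + rpp_weight shape (delta n) pi.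
Proof.
rewrite -sum_strip_sizes mulKn // /weight sum_mkseq /rpp_weight.
have strip_lt x : strip x < k by case: (square_coords x).
rewrite (partition_big (fun x => Ordinal (strip_lt x)) xpredT) //= -big_split.
apply: eq_bigr => i _ /=.
rewrite sum_mkseq big_split /= sum_strip sum_nat_const card_ord addnC.
by congr (_ + _).
Qed.

(** Right and lower neighbours in terms of places: from a valley at place [t]
they are the peaks at [t.+1] and [t.-1] of the same strip; from a peak at
place [t] they are the valleys at [t.+3] and [t.+1] of the next strip. *)
Lemma strips_RPP pi : RPP shape (delta n) pi -> strict_strips n k (strips pi).
Proof.
move=> /RPP_covers covP.
have at_coords i t : i < k -> t <= 2 * (n + 2 * i) -> exists x,
    [/\ strip x = i, place x = t, sqcol x = t./2, sqrow x + uphalf t = n + 2 * i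
      & nth 0 (row (strips pi) i) t = pi x + i].
  move=> ik lt; have [x [si pt]] := square_in_strip ik lt.
  have [_ _ cx rx] := square_coords x.
  by exists x; split=> //; rewrite -?si -?pt // nth_strips.
split=> [|i ik|i t ik et lt]; first by rewrite size_mkseq.
  rewrite {1}row_strips // size_mkseq; split=> //.
  apply/alternating_nth => t; rewrite {1}row_strips // size_mkseq ltnS => lt.
  have [x [_ _ cx rx ->]] := at_coords i t ik (ltnW lt).
  have [y [_ _ cy ry ->]] := at_coords i t.+1 ik lt.
  by rewrite /zig; case: ifP => ot; rewrite leq_add2r; apply: covP;
    rewrite /covers; lia.
have [x [_ _ cx rx ->]] := at_coords i t (ltnW ik) lt.
have [|y [_ _ cy ry ->]] := at_coords i.+1 t.+1 ik; first by lia.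
have [|z [_ _ cz rz ->]] := at_coords i.+1 t.+3 ik; first by lia.
by rewrite !addnS !ltnS; split; rewrite leq_add2r; apply: covP;
  rewrite /covers; lia.
Qed.

Lemma RPP_strips P : strict_strips n k P ->
  exists2 pi, RPP shape (delta n) pi & strips pi = P.
Proof.
move=> sP; have [szP rowP lt_rows] := sP.
pose pi := [ffun x : sq => nth 0 (row P (strip x)) (place x) - strip x].
have zigP i t : i < k -> t < 2 * (n + 2 * i) ->
    zig t (nth 0 (row P i) t) (nth 0 (row P i) t.+1).
  move=> ik lt; have [sz alt] := rowP i ik.
  by apply: (alternating_nth _).1 => //; rewrite sz.
exists pi; last first.
  apply: (@eq_from_nth _ [::]); rewrite size_mkseq ?szP // => i ik.
  have [sz _] := rowP i ik; rewrite -/(row (strips pi) i) -/(row P i).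
  apply: (@eq_from_nth _ 0); rewrite row_strips // size_mkseq ?sz // => t lt.
  have [x [sx px]] := square_in_strip ik lt.
  rewrite nth_mkseq // -[in LHS]sx -px entry_square ffunE sx px subnK //.
  exact: (strips_ge sP).
apply/RPP_covers => x y /and3P[rxy cxy /eqP dxy]; rewrite !ffunE.
have [sx px cx rx] := square_coords x; have [sy py cy ry] := square_coords y.
case: (boolP (odd (place x))) => ox.
  have eq_s : strip y = strip x by lia.
  rewrite eq_s leq_sub2r //.
  have [pE|pE] : place y = (place x).+1 \/ place x = (place y).+1 by lia.
    by have := zigP _ (place x) sx; rewrite /zig ox pE; apply; lia.
  by have := zigP _ (place y) sx; rewrite pE /zig ifF; [apply; lia | lia].
have eq_s : strip y = (strip x).+1 by lia.
rewrite eq_s in sy *; have [lt1 lt3] := lt_rows _ _ sy ox px.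
have [->|->] : place y = (place x).+1 \/ place y = (place x).+3 by lia.
  by lia.
by lia.
Qed.

End Squares.

(** * Generating functions *)

Local Open Scope classical_set_scope.

Lemma fps_mul_qpow N (g : fps) m :
  fps_mul (fps_qpow N) g m = if N <= m then g (m - N) else 0.
Proof.
rewrite /fps_mul /fps_qpow; case: leqP => [Nm|mN].
  rewrite (bigD1 (Ordinal (Nm : N < m.+1))) //= eqxx mul1n big1 ?addn0 //.
  by move=> i; rewrite -val_eqE /= => /negbTE->.
by rewrite big1 // => i _; rewrite ltn_eqF // (leq_trans _ mN).
Qed.

(** Each value is bounded by the sum, so a level embeds in the functions with
values in a finite ordinal. *)
Lemma summable_ffun (T : finType) (B : set {ffun T -> nat}) :
  summable B (fun f => \sum_x f x).
Proof.
move=> m; apply: (@sub_finite_set _ _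
  [set [ffun x => val (g x)] | g in [set: {ffun T -> 'I_m.+1}]]); last first.
  by apply: finite_image; apply: finite_finset.
move=> f [_ <-]; exists [ffun x => inord (f x)] => //.
apply/ffunP => x; rewrite !ffunE /= inordK //.
by rewrite ltnS (bigD1 x) //= leq_addr.
Qed.

Lemma genfun_image (T U : choiceType) (f : T -> U) (B : set T)
    (w : T -> nat) (w' : U -> nat) N :
  injective f -> (forall x, w' (f x) = N + w x) -> summable B w ->
  summable (f @` B) w' /\
  genfun (f @` B) w' = fps_mul (fps_qpow N) (genfun B w).
Proof.
move=> f_inj wE sumB.
have levelE m : level (f @` B) w' m =
    if N <= m then f @` level B w (m - N) else set0.
  apply/seteqP; split=> [y [[x Bx <-]]|].
    by rewrite wE => <-; rewrite leq_addr; exists x => //; split=> //; lia.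
  case: leqP => // Nm _ [x [Bx wx] <-]; split; first by exists x.
  by rewrite wE wx subnKC.
split=> [m|].
  by rewrite levelE; case: ifP => _; [apply: finite_image | apply: finite_set0].
apply/funext => m; rewrite fps_mul_qpow /genfun levelE.
case: ifP => _; last by rewrite fset_set0.
by rewrite fset_set_image ?card_imfset.
Qed.

Lemma FA_image n k : 0 < n ->
  FA n k = @strips n k @` RPP (delta (n + 2 * k)) (delta n).
Proof.
move=> hn; apply/seteqP; split=> [P /fixed_strips/(RPP_strips hn)[pi Rpi <-]|].
  by exists pi.
by move=> _ [pi Rpi <-]; apply/strips_fixed/strips_RPP.
Qed.

Theorem theorem3p5 (n k : nat) (hn : 0 < n) (hk : 0 < k) :
  let N := (k * (k - 1) * (6 * n + 8 * k - 1)) %/ 6 in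
  let shape := delta (n + 2 * k) in
  [/\ summable (FA n k) weight,
      summable (RPP shape (delta n)) (rpp_weight shape (delta n))
    & genfun (FA n k) weight =
      fps_mul (fps_qpow N)
        (genfun (RPP shape (delta n)) (rpp_weight shape (delta n)))].
Proof.
move=> N shape.
have sumR : summable (RPP shape (delta n)) (rpp_weight shape (delta n)).
  exact: summable_ffun.
rewrite (FA_image k hn).
by have [] := genfun_image (strips_inj hn) (weight_strips hn) sumR.
Qed.
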